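(* Let $F\subset\mathbb{R}^2$ be compact, convex, with nonempty interior, let $X_m$ be a finite $\eta_m$-net of $X=F\times O(2)$ (with respect to $d_X$) with $\eta_m\downarrow 0$, let $D_m$ be the optimal value of the associated sampled minimum-diameter traveling salesman problem with neighborhoods, let $A=\operatorname{Area}(F)$, and assume $D_m>0$. Then $$\mathcal{L}\le\frac{A}{D(F)^2}\le\frac{A}{D_m^2}.$$ Moreover, $$\frac{A}{(D_m+2\eta_m)^2}\le\frac{A}{D(F)^2}\le\frac{A}{D_m^2}.$$ Thus $A/D_m^2$ is an upper bound for the Lebesgue universal covering constant $\mathcal{L}$, and these bounds converge to the exact ratio $A/D(F)^2$ as $m\to\infty$.
   Context: $O(2)$ is the full orthogonal group of $\mathbb{R}^2$, $\|\cdot\|$ the Euclidean norm, $\|\cdot\|_{\mathrm{op}}$ the operator norm. A Lebesgue universal cover is a compact convex set $U\subset\mathbb{R}^2$ with nonempty interior such that every compact $S\subset\mathbb{R}^2$ with $\operatorname{diam}S\le1$ satisfies $a+QS\subset U$ for some $a\in\mathbb{R}^2$, $Q\in O(2)$. The Lebesgue universal covering constant is $\mathcal{L}:=\inf\{\operatorname{Area}(U):U\text{ is a Lebesgue universal cover}\}$. A closed path is a continuous map $\gamma:[0,1]\to\mathbb{R}^2$ with $\gamma(0)=\gamma(1)$; its trace is $\Gamma=\gamma([0,1])$ and $\operatorname{diam}\gamma:=\operatorname{diam}\Gamma$. It is a diameter-escape path for $F$ if $a+Q\Gamma\not\subset\operatorname{int}F$ for every $a\in\mathbb{R}^2$, $Q\in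 O(2)$. The critical escape diameter is $D(F):=\inf\{\operatorname{diam}\gamma:\gamma\text{ is a closed diameter-escape path for }F\}$. On $X=F\times O(2)$ use the metric $d_X((x,Q),(y,P)):=\|x-y\|+\operatorname{diam}(F)\,\|Q-P\|_{\mathrm{op}}$. A finite $\eta$-net is a finite subset of $X$ such that every point of $X$ is within $d_X$-distance at most $\eta$ of it. For $\xi=(x,Q)\in X$ put $\mathcal{N}_\xi:=Q^{T}(\partial F-x)$. For each $m$ let $X_m=\{\xi_1^m,\dots,\xi_{M_m}^m\}$ and $\mathcal{N}_j^m:=\mathcal{N}_{\xi_j^m}$. For points $p_j\in\mathcal{N}_j^m$ ($1\le j\le M_m$) and a permutation $\pi$ of $\{1,\dots,M_m\}$, let $\Gamma_{\pi,p}$ be the closed polygonal tour $[0,p_{\pi(1)}]\cup\bigcup_{k=1}^{M_m-1}[p_{\pi(k)},p_{\pi(k+1)}]\cup[p_{\pi(M_m)},0]$. Then $$D_m:=\min_{\pi,\ p_j\in\mathcal{N}_j^m}\operatorname{diam}\Gamma_{\pi,p}=\min_{p_j\in\mathcal{N}_j^m}\ \max_{0\le r<s\le M_m}\|p_r-p_s\|,\qquad p_0:=0.$$ *)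

(* Defs.v *)
From HB Require Import structures.
From mathcomp Require Import all_boot all_order all_algebra all_fingroup.
From mathcomp Require Import all_classical all_reals all_analysis.

Set Implicit Arguments.
Unset Strict Implicit.
Unset Printing Implicit Defensive.

Import Order.TTheory GRing.Theory Num.Theory.
Import numFieldNormedType.Exports.

Local Open Scope classical_set_scope.
Local Open Scope ring_scope.

(* The plane is R * R, with its product topology and the product of two copies
   of the one-dimensional Lebesgue measure.  The library norm on R * R is the
   sup norm, so the Euclidean norm is defined separately. *)
Notation plane R := (R * R)%type.

Section Plane.
Context {R : realType}.
Implicit Types (x y a : plane R) (Q P : 'M[R]_2) (S F U : set (plane R)).

Definition enorm x : R := Num.sqrt (x.1 ^+ 2 + x.2 ^+ 2).

(* The supremum is a real one: it has its intended meaning on nonempty bounded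
   sets, and diam set0 = 0. *)
Definition diam S : R :=
  sup [set d | exists x y, [/\ S x, S y & d = enorm (x - y)]].

Definition area S : \bar R :=
  ((@lebesgue_measure R) \x (@lebesgue_measure R))%E S.

Definition boundary S : set (plane R) := closure S `\` S°.

Definition segment x y : set (plane R) :=
  [set (1 - t) *: x + t *: y | t in `[0, 1]].

Definition mxact Q x : plane R :=
  (Q 0 0 * x.1 + Q 0 1 * x.2, Q 1 0 * x.1 + Q 1 1 * x.2).

Definition O2 : set 'M[R]_2 := [set Q | Q *m Q^T = 1%:M].

Definition opnorm Q : R := sup [set enorm (mxact Q x) | x in [set x | enorm x <= 1]].

Definition place a Q S : set (plane R) := [set a + mxact Q x | x in S].

Definition universal_cover U : Prop :=
  [/\ compact U, convex_set U, U° !=set0 &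
    forall S, compact S -> diam S <= 1 ->
      exists a Q, O2 Q /\ place a Q S `<=` U].

Definition lebesgue_const : \bar R :=
  ereal_inf [set area U | U in universal_cover].

Definition closed_path (g : R -> plane R) : Prop :=
  {within `[0, 1], continuous g} /\ g 0 = g 1.

Definition trace (g : R -> plane R) : set (plane R) := g @` `[0, 1].

Definition escape_path F (g : R -> plane R) : Prop :=
  closed_path g /\
  forall a Q, O2 Q -> ~ (place a Q (trace g) `<=` F°).

Definition escape_diam F : R := inf [set diam (trace g) | g in escape_path F].

Definition config F : set (plane R * 'M[R]_2) := F `*` O2.

Definition config_dist F (xi zeta : plane R * 'M[R]_2) : R :=
  enorm (xi.1 - zeta.1) + diam F * opnorm (xi.2 - zeta.2).

Definition finite_net F (eta : R) (N : set (plane R * 'M[R]_2)) : Prop :=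
  [/\ finite_set N, N `<=` config F &
    forall zeta, config F zeta ->
      exists2 xi, N xi & config_dist F zeta xi <= eta].

Definition neighborhood F (xi : plane R * 'M[R]_2) : set (plane R) :=
  [set mxact xi.2^T (y - xi.1) | y in boundary F].

(* The vertices are 0, p_(pi 0), ..., p_(pi (n-1)); as nth returns 0 past the
   end of the list, the last of the n+1 segments is the closing one, from
   p_(pi (n-1)) back to 0. *)
Definition tour n (pi : 'S_n) (p : 'I_n -> plane R) : set (plane R) :=
  let v := 0 :: [seq p (pi k) | k <- enum 'I_n] in
  \bigcup_(k in `I_n.+1) segment v`_k v`_k.+1.

(* The minimum over all visiting orders and choices of points is written as an
   infimum; it is attained when F is compact with nonempty interior and each
   xi j lies in config F, since the neighborhoods are then nonempty and
   compact. *)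
Definition sampled_opt F n (xi : 'I_n -> plane R * 'M[R]_2) : R :=
  inf [set d | exists (pi : 'S_n) (p : 'I_n -> plane R),
    (forall j, neighborhood F (xi j) (p j)) /\ d = diam (tour pi p)].

End Plane.

(* Main.v *)
Require Import Defs.
From HB Require Import structures.
From mathcomp Require Import all_boot all_order all_algebra all_fingroup.
From mathcomp Require Import all_classical all_reals all_analysis.
From mathcomp Require Import measurable_realfun ring lra.
Import Order.TTheory GRing.Theory Num.Theory.
Import numFieldNormedType.Exports.
Local Open Scope classical_set_scope.
Local Open Scope ring_scope.

(** Everything rests on two comparisons, for a sampled optimum D_m > 0,
    D_m <= D(F) <= D_m + 2 eta_m, and on the inequality L <= A / D(F)^2. The
    quotients by A are then monotone in the diameter, and the convergence
    statements follow by squeezing, as eta_m tends to 0.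

    D_m <= D(F): translate an escape path so that it passes through 0. For every
    net point (x, Q), the copy of the path placed at x with orientation Q meets F
    at x and is not contained in the interior of F. By connectedness it meets the
    boundary of F, so the path meets the neighborhood of (x, Q). The tour through
    these meeting points has at most the diameter of the path, since the diameter
    of a polygon is attained at its vertices (sampled_opt_le_escape).

    D(F) <= D_m + 2 eta_m: given a feasible tour with vertices p_j, any
    configuration (a, Q) with a in F is within eta_m of a net point, and the
    image of the corresponding p_j is within eta_m of the boundary of F. So a
    path whose convex hull contains all discs of radius eta_m around the p_j
    escapes (net_flower_escape). Such a path is given by an explicit formula, the
    flower: it runs along the segments from 0 to the p_j, rests for a while at
    each of them, and is superposed with a fast rotation of radius eta_m, so that
    it draws the full circle around each p_j. Its diameter exceeds that of the
    tour by at most 2 eta_m (flower_diam), and by convexity the circles are as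
    good as the discs (flower_disc).

    L <= A / D(F)^2: for 0 < c < D(F), the set F dilated by 1/c is a universal
    cover (scaled_universal_cover). Indeed let S have diameter at most 1. The
    flower through a fine net of cS with small circles has diameter below D(F),
    so it does not escape, and the copy of it inside F carries along a copy of
    cS. The area of the dilated set is A / c^2, by uniqueness of the Lebesgue
    and product measures (area_scale); letting c tend to D(F) gives the bound
    (lebesgue_const_le). *)

(** * Euclidean norm and orthogonal matrices *)

Section Euclid.
Context {R : realType}.
Implicit Types (x y z a : plane R) (Q P : 'M[R]_2) (c d t : R).

Lemma plane_eq x y : x.1 = y.1 -> x.2 = y.2 -> x = y.
Proof. by case: x y => [x1 x2] [y1 y2] /= -> ->. Qed.

Lemma enorm_ge0 x : 0 <= enorm x.
Proof. exact: sqrtr_ge0. Qed.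

Lemma sqr_enorm x : enorm x ^+ 2 = x.1 ^+ 2 + x.2 ^+ 2.
Proof. by rewrite sqr_sqrtr// addr_ge0 ?sqr_ge0. Qed.

Lemma enorm_le x d : 0 <= d -> x.1 ^+ 2 + x.2 ^+ 2 <= d ^+ 2 -> enorm x <= d.
Proof. by move=> d0 xd; rewrite -(ger0_norm d0) -sqrtr_sqr; exact: ler_wsqrtr. Qed.

Lemma enorm0 : enorm 0 = 0 :> R.
Proof. by rewrite /enorm/= expr0n/= addr0 sqrtr0. Qed.

Lemma enormZ c x : enorm (c *: x) = `|c| * enorm x.
Proof.
rewrite /enorm/= -sqrtr_sqr -sqrtrM ?sqr_ge0//; congr Num.sqrt.
by rewrite /GRing.scale/=; ring.
Qed.

Lemma enormN x : enorm (- x) = enorm x.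
Proof. by rewrite /enorm/= !sqrrN. Qed.

Lemma enormBC x y : enorm (x - y) = enorm (y - x).
Proof. by rewrite -enormN opprB. Qed.

Lemma enormD x y : enorm (x + y) <= enorm x + enorm y.
Proof.
apply: enorm_le; first by rewrite addr_ge0 ?enorm_ge0.
have cs : x.1 * y.1 + x.2 * y.2 <= enorm x * enorm y.
  apply: (le_trans (ler_norm _)).
  rewrite -ler_sqr ?nnegrE ?mulr_ge0 ?enorm_ge0 ?normr_ge0// real_normK ?num_real//.
  rewrite exprMn !sqr_enorm -subr_ge0.
  rewrite (_ : _ - _ = (x.1 * y.2 - x.2 * y.1) ^+ 2) ?sqr_ge0//; ring.
rewrite [leRHS]sqrrD !sqr_enorm/=; lra.
Qed.

Lemma norm_fst_le x : `|x.1| <= enorm x.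
Proof. by rewrite -sqrtr_sqr ler_wsqrtr// lerDl sqr_ge0. Qed.

Lemma norm_snd_le x : `|x.2| <= enorm x.
Proof. by rewrite -sqrtr_sqr ler_wsqrtr// lerDr sqr_ge0. Qed.

Lemma enorm_le_sum x : enorm x <= `|x.1| + `|x.2|.
Proof.
apply: enorm_le; first by rewrite addr_ge0.
rewrite sqrrD !real_normK ?num_real// [leRHS]addrAC lerDl.
by rewrite mulrn_wge0 ?mulr_ge0.
Qed.

Lemma mxactD Q x y : mxact Q (x + y) = mxact Q x + mxact Q y.
Proof. by apply: plane_eq => /=; ring. Qed.

Lemma mxactN Q x : mxact Q (- x) = - mxact Q x.
Proof. by apply: plane_eq => /=; ring. Qed.

Lemma mxactB Q x y : mxact Q (x - y) = mxact Q x - mxact Q y.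
Proof. by rewrite mxactD mxactN. Qed.

Lemma mxactZ Q c x : mxact Q (c *: x) = c *: mxact Q x.
Proof.
have scaleE z : c *: z = (c * z.1, c * z.2) by [].
by rewrite !scaleE; apply: plane_eq => /=; ring.
Qed.

Lemma mxact0 Q : mxact Q 0 = 0.
Proof. by apply: plane_eq; rewrite /= !mulr0 addr0. Qed.

Lemma mxact_subl Q P x : mxact (Q - P) x = mxact Q x - mxact P x.
Proof. by apply: plane_eq; rewrite /= !mxE; ring. Qed.

Lemma mxactM Q P x : mxact (Q *m P) x = mxact Q (mxact P x).
Proof.
have lift1 : lift ord0 ord0 = 1 :> 'I_2 by exact/val_inj.
by apply: plane_eq; rewrite /= !mxE !big_ord_recl !big_ord0/= !lift1; ring.
Qed.

Lemma mxact1 x : mxact 1%:M x = x.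
Proof. by apply: plane_eq; rewrite /= !mxE/=; ring. Qed.

Lemma mxactK Q x : O2 Q -> mxact Q^T (mxact Q x) = x.
Proof. by move=> /mulmx1C QQ; rewrite -mxactM QQ mxact1. Qed.

Lemma mxactKT Q x : O2 Q -> mxact Q (mxact Q^T x) = x.
Proof. by move=> QQ; rewrite -mxactM QQ mxact1. Qed.

Lemma enorm_mxact Q x : O2 Q -> enorm (mxact Q x) = enorm x.
Proof.
move=> /mulmx1C QQ; have := mxactM Q^T Q x; rewrite QQ mxact1 => xE.
suff: enorm (mxact Q x) ^+ 2 = enorm x ^+ 2.
  by move=> /eqP; rewrite eqrXn2 ?enorm_ge0// => /eqP.
rewrite !sqr_enorm {2}xE.
have e1 : x.1 = Q 0 0 * (mxact Q x).1 + Q 1 0 * (mxact Q x).2.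
  by rewrite {1}xE/= !mxE.
have e2 : x.2 = Q 0 1 * (mxact Q x).1 + Q 1 1 * (mxact Q x).2.
  by rewrite {1}xE/= !mxE.
rewrite -xE; transitivity (x.1 * x.1 + x.2 * x.2); last by ring.
rewrite {1}e1 {1}e2 /=; ring.
Qed.

End Euclid.

(** * Diameter, operator norm and convexity in the plane *)

Section PlaneTopology.
Context {R : realType}.
Implicit Types (x y z a b u w : plane R) (Q P : 'M[R]_2) (c d e t : R).
Implicit Types (S F : set (plane R)).

Lemma enorm_nbhs x e : 0 < e -> nbhs x [set y | enorm (y - x) < e].
Proof.
move=> e0; apply/nbhs_ballP; exists (e / 2) => /=; first by rewrite divr_gt0.
move=> y [/=]; rewrite /ball/= => y1 y2.
apply: (le_lt_trans (enorm_le_sum _)); rewrite /= ![`|y.1 - _|]distrC.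
by rewrite ![`|y.2 - _|]distrC [e]splitr ltrD.
Qed.

(** The topology of the product is given by the sup norm; the Euclidean balls
    generate the same one, and all later arguments on interiors use them. *)
Lemma interior_enormP S x :
  S° x <-> exists2 e, 0 < e & forall y, enorm (y - x) < e -> S y.
Proof.
split=> [/nbhs_ballP[e /= e0 eS]|[e e0 eS]].
  exists e => // y yx; apply: eS; split => /=; rewrite /ball/= distrC.
    exact: le_lt_trans (norm_fst_le (y - x)) yx.
  exact: le_lt_trans (norm_snd_le (y - x)) yx.
by apply: filterS (enorm_nbhs x e e0).
Qed.

Lemma isometry_continuous (f : plane R -> plane R) :
  (forall x y, enorm (f x - f y) = enorm (x - y)) -> continuous f.
Proof.
move=> isof x U /interior_enormP[e e0 eU]; rewrite nbhs_filterE.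
by apply: filterS (enorm_nbhs x e e0) => y /= yx; apply: eU; rewrite isof.
Qed.

Lemma compact_net S e : compact S -> 0 < e ->
  exists s : seq (plane R), (forall x, x \in s -> S x) /\
    forall y, S y -> exists2 x, x \in s & enorm (y - x) <= e.
Proof.
rewrite (compact_cover ((R * R)%type : normedModType R)) => cS e0.
have [||D DS SD] := cS _ S (fun x => [set y | enorm (y - x) < e]°).
- by move=> x _; exact: open_interior.
- by move=> x Sx; exists x => //; exact: enorm_nbhs.
exists (finmap.enum_fset D); split; first by move=> x /DS /set_mem.
move=> y /SD[x /= xD /interior_subset/= yx]; exists x => //; exact: ltW.
Qed.

Lemma compact_enorm_bounded S : compact S ->
  exists B, forall x y, S x -> S y -> enorm (x - y) <= B.
Proof.
move=> /compact_bounded/pinfty_ex_gt0[B B0 SB].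
exists ((B + B) + (B + B)) => x y Sx Sy; have := SB x Sx; have := SB y Sy.
rewrite /= !prod_normE/= !ge_max => /andP[y1 y2] /andP[x1 x2].
apply: (le_trans (enorm_le_sum _)).
by apply: lerD; exact: (le_trans (ler_normB _ _) (lerD _ _)).
Qed.

(** Otherwise S would be split by F and its interior, which trace on S the same
    set, at once open and closed in S. *)
Lemma connected_boundary S F : connected S -> closed F ->
  S `&` F !=set0 -> ~ S `<=` F° -> exists2 y, S y & boundary F y.
Proof.
move=> conS cF SF nSF; apply: contrapT => noB; apply: nSF.
suff SFS : S `&` F = S.
  move=> x Sx; have Fx : F x by have [] : (S `&` F) x by rewrite SFS.
  apply: contrapT => nFx; apply: noB; exists x => //; split=> //.
  exact: subset_closure.
apply: conS => //; last by exists F.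
exists F°; first exact: open_interior.
apply/seteqP; split => x [Sx Fx]; split => //; last exact: interior_subset.
by apply: contrapT => nFx; apply: noB; exists x => //; split=> //;
  exact: subset_closure.
Qed.

Lemma diam0 : diam set0 = 0 :> R.
Proof.
rewrite /diam (_ : [set _ | _] = set0) ?sup0//.
by apply/seteqP; split => // d [x [y [[]]]].
Qed.

Lemma diam_le S d : 0 <= d ->
  (forall x y, S x -> S y -> enorm (x - y) <= d) -> diam S <= d.
Proof.
move=> d0 Sd; have [->|/set0P[x Sx]] := eqVneq S set0.
  by rewrite diam0.
apply: ge_sup; first by exists (enorm (x - x)), x, x.
by move=> _ [y [z [Sy Sz ->]]]; exact: Sd.
Qed.

(** The bound B makes the real supremum that defines the diameter meaningful. *)
Lemma enorm_le_diam S B x y :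
  (forall z w, S z -> S w -> enorm (z - w) <= B) ->
  S x -> S y -> enorm (x - y) <= diam S.
Proof.
move=> SB Sx Sy; apply: ub_le_sup; last by exists x, y.
by exists B => _ [z [w [Sz Sw ->]]]; exact: SB.
Qed.

Lemma compact_le_diam S x y :
  compact S -> S x -> S y -> enorm (x - y) <= diam S.
Proof. by move=> /compact_enorm_bounded[B]; exact: enorm_le_diam. Qed.

(** This holds even for an unbounded set, whose real supremum is 0. *)
Lemma diam_ge0 S : 0 <= diam S.
Proof.
have [[[_ [x [y [Sx Sy _]]]] ub]|nosup] :=
    pselect (has_sup [set d | exists x y, [/\ S x, S y & d = enorm (x - y)]]).
  apply: le_trans (enorm_ge0 (x - y)) _.
  by apply: ub_le_sup => //; exists x, y.
by rewrite /diam sup_out.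
Qed.

Lemma mxact_le_opnorm Q x : enorm (mxact Q x) <= opnorm Q * enorm x.
Proof.
pose B := `|Q 0 0| + `|Q 0 1| + (`|Q 1 0| + `|Q 1 1|).
have opB y : enorm y <= 1 -> enorm (mxact Q y) <= opnorm Q.
  move=> y1; apply: ub_le_sup; last by exists y.
  exists B => _ [z /= z1 <-]; apply: (le_trans (enorm_le_sum _)) => /=.
  have le1 (q r : R) : `|r| <= enorm z -> `|q * r| <= `|q|.
    by move=> rz; rewrite normrM ler_piMr// (le_trans rz).
  by apply: lerD; apply: (le_trans (ler_normD _ _)); apply: lerD;
    apply: le1; rewrite ?norm_fst_le ?norm_snd_le.
have [x0|x0] := eqVneq (enorm x) 0.
  have -> : x = 0.
    apply: plane_eq; apply/normr0_eq0/le_anti; rewrite normr_ge0 andbT -x0.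
      exact: norm_fst_le.
    exact: norm_snd_le.
  by rewrite mxact0 enorm0 mulr0.
have xp : 0 < enorm x by rewrite lt_neqAle eq_sym x0 enorm_ge0.
have := opB ((enorm x)^-1 *: x); rewrite mxactZ !enormZ.
rewrite ger0_norm ?invr_ge0 ?enorm_ge0//.
by rewrite mulVf// lexx => /(_ isT); rewrite ler_pdivrMl// mulrC.
Qed.

Lemma opnorm_ge0 Q : 0 <= opnorm Q.
Proof.
have := mxact_le_opnorm Q (1, 0); rewrite {2}/enorm/= expr1n expr0n addr0 sqrtr1 mulr1.
exact: le_trans (enorm_ge0 _).
Qed.

Lemma convex_setP F : convex_set F <->
  forall x y t, 0 <= t -> t <= 1 -> F x -> F y -> F ((1 - t) *: x + t *: y).
Proof.
split=> [cF x y t t0 t1 Fx Fy|cF x y l /set_mem Fx /set_mem Fy].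
  have := cF y x (Itv01 t0 t1) (mem_set Fy) (mem_set Fx).
  by rewrite inE /conv/= /unstable.onem addrC.
rewrite inE /conv/= /unstable.onem addrC; apply: cF => //.
Qed.

Lemma convex_interior F : convex_set F -> convex_set F°.
Proof.
move=> /convex_setP cF; apply/convex_setP => x y t t0 t1.
move=> /interior_enormP[d d0 dF] /interior_enormP[e e0 eF].
apply/interior_enormP; exists (Num.min d e); first by rewrite lt_min d0.
move=> z; rewrite lt_min; set m := _ *: x + _ *: y => /andP[zd ze].
have mE v : m + v = (1 - t) *: (x + v) + t *: (y + v).
  by rewrite !scalerDr addrACA -/m -scalerDl subrK scale1r.
rewrite -(subrK m z) addrC mE.
by apply: cF => //; [apply: dF|apply: eF]; rewrite addrAC subrr add0r.
Qed.

Lemma segment_enorm_le a b z d x : enorm (a - z) <= d -> enorm (b - z) <= d ->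
  segment a b x -> enorm (x - z) <= d.
Proof.
move=> az bz [t /=]; rewrite in_itv/= => /andP[t0 t1] <-.
have -> : (1 - t) *: a + t *: b - z = (1 - t) *: (a - z) + t *: (b - z).
  by rewrite !scalerBr addrACA -opprD -scalerDl subrK scale1r.
apply: (le_trans (enormD _ _)); rewrite !enormZ !ger0_norm ?subr_ge0//.
rewrite [leRHS](_ : d = (1 - t) * d + t * d); last by ring.
by apply: lerD; apply: ler_wpM2l => //; rewrite subr_ge0.
Qed.

Lemma segment_diam_le a b a' b' d x y :
  enorm (a - a') <= d -> enorm (a - b') <= d ->
  enorm (b - a') <= d -> enorm (b - b') <= d ->
  segment a b x -> segment a' b' y -> enorm (x - y) <= d.
Proof.
move=> aa ab ba bb xs ys; rewrite enormBC.
apply: segment_enorm_le ys; rewrite enormBC; exact: segment_enorm_le xs.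
Qed.

(** A convex set containing a circle contains the disc that it bounds: w lies
    between two antipodal points of the circle of radius e. This is why a path
    drawing only circles can do the work of the full discs. *)
Lemma convex_circle F a Q p e : convex_set F ->
  (forall u, enorm u = 1 -> F (a + mxact Q (p + e *: u))) ->
  forall w, enorm w <= e -> F (a + mxact Q (p + w)).
Proof.
move=> /convex_setP cF Fu w we.
have [u u1 wE] : exists2 u, enorm u = 1 & w = enorm w *: u.
  have [w0|w0] := eqVneq (enorm w) 0.
    exists (1, 0); first by rewrite /enorm/= expr1n expr0n addr0 sqrtr1.
    rewrite w0 scale0r; apply: plane_eq; apply/normr0_eq0/le_anti;
      rewrite normr_ge0 andbT -w0 ?norm_fst_le ?norm_snd_le//.
  exists ((enorm w)^-1 *: w); last by rewrite scalerA mulfV// scale1r.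
  by rewrite enormZ ger0_norm ?invr_ge0 ?enorm_ge0// mulVf.
(* The case e = 0 goes through because a quotient by 0 is 0. *)
have r1 : enorm w / e <= 1.
  have [->|e0] := eqVneq e 0; first by rewrite invr0 mulr0.
  by rewrite ler_pdivrMr ?mul1r// lt_neqAle eq_sym e0 (le_trans (enorm_ge0 w)).
have r0 : 0 <= enorm w / e.
  by rewrite divr_ge0 ?enorm_ge0// (le_trans (enorm_ge0 w)).
pose t := (1 + enorm w / e) / 2.
have -> : a + mxact Q (p + w) =
    (1 - t) *: (a + mxact Q (p + e *: - u)) + t *: (a + mxact Q (p + e *: u)).
  have tw : w = (2 * t - 1) *: (e *: u).
    rewrite {1}wE scalerA; congr (_ *: _); rewrite /t.
    have [e0|e0] := eqVneq e 0; last by field.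
    by rewrite e0 mulr0; apply/le_anti; rewrite enorm_ge0 -e0 we.
  rewrite !mxactD !mxactZ mxactN {1}tw !mxactZ.
  have scaleE k (v : plane R) : k *: v = (k * v.1, k * v.2) by [].
  by rewrite !scaleE; apply: plane_eq => /=; ring.
apply: cF; rewrite /t; [lra|lra| |exact: Fu].
by apply: Fu; rewrite enormN.
Qed.

End PlaneTopology.

(** * A closed path through small circles *)

Section Flower.
Context {R : realType}.
Implicit Types (x y z a u w : plane R) (Q P : 'M[R]_2) (c d e s t : R).
Implicit Types (vs : seq (plane R)) (k l : nat).

(** The plateau [-1, 1] is long enough to contain a full period of unit_loop. *)
Definition bump s : R := Num.max 0 (Num.min 1 (2 - `|s|)).

(** Consecutive centers are 4 apart, so the bumps centered there have disjoint
    supports, the first of them starting at 0. *)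
Definition bump_center k : R := 4 * k%:R + 2.

(** A motion that leaves 0 for a point of vs along a straight segment, rests
    there, returns to 0 and goes on to the next point. *)
Definition spokes vs s : plane R :=
  \sum_(k < size vs) bump (s - bump_center k) *: vs`_k.

Definition unit_loop s : plane R := (cos (2 * pi * s), sin (2 * pi * s)).

(** The spokes motion superposed with a fast rotation of radius e: while the
    motion rests at a point of vs, the path draws the whole circle of radius e
    around it. *)
Definition flower vs e t : plane R :=
  let s := 4 * (size vs)%:R * t in spokes vs s + e *: unit_loop s.

Lemma bump_ge0 s : 0 <= bump s.
Proof. by rewrite /bump le_max lexx. Qed.

Lemma bump_le1 s : bump s <= 1.
Proof. by rewrite /bump ge_max ler01 ge_min lexx. Qed.

Lemma bump_eq0 s : 2 <= `|s| -> bump s = 0.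
Proof.
by move=> s2; rewrite /bump; apply/max_idPl; rewrite ge_min subr_le0 s2 orbT.
Qed.

Lemma bump_eq1 s : `|s| <= 1 -> bump s = 1.
Proof.
move=> s1; rewrite /bump; have -> : Num.min 1 (2 - `|s|) = 1 by apply/min_idPl; lra.
by apply/max_idPr.
Qed.

Lemma bump_continuous : continuous bump.
Proof.
move=> s; rewrite /bump.
apply: (@continuous_max R R (cst 0) (fun s => Num.min 1 (2 - `|s|)) s).
  exact: cvg_cst.
apply: (@continuous_min R R (cst 1) (fun s => 2 - `|s|) s); first exact: cvg_cst.
by apply: cvgB; [exact: cvg_cst|apply: cvg_norm; exact: cvg_id].
Qed.

Lemma bump_center_sep k l s :
  `|s - bump_center k| < 2 -> `|s - bump_center l| < 2 -> k = l.
Proof.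
rewrite !ltr_norml /bump_center => /andP[k1 k2] /andP[l1 l2].
have sep (a b : R) : a + 1 <= b -> -2 < s - (4 * a + 2) ->
  s - (4 * b + 2) < 2 -> s - (4 * a + 2) < 2 -> -2 < s - (4 * b + 2) -> False.
  by clear; move=> ab h1 h2 h3 h4; lra.
have natS m n : (m < n)%N -> m%:R + 1 <= n%:R :> R by rewrite natr1 ler_nat.
have [kl|kl|//] := ltngtP k l; exfalso.
  have kl' := natS _ _ kl.
  exact: (sep _ _ kl' k1 l2 k2 l1).
have kl' := natS _ _ kl.
exact: (sep _ _ kl' l1 k2 l2 k1).
Qed.

Lemma spokesE vs k s : (k < size vs)%N -> `|s - bump_center k| < 2 ->
  spokes vs s = bump (s - bump_center k) *: vs`_k.
Proof.
move=> kn sk; rewrite /spokes (bigD1 (Ordinal kn))//= big1 ?addr0// => l lk.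
rewrite bump_eq0 ?scale0r// leNgt; apply: contra lk => sl.
exact/eqP/val_inj/esym/(bump_center_sep k l s).
Qed.

Lemma spokes_eq0 vs s : (forall k, (k < size vs)%N -> 2 <= `|s - bump_center k|) ->
  spokes vs s = 0.
Proof. by move=> h; rewrite /spokes big1// => k _; rewrite bump_eq0 ?h ?scale0r. Qed.

Lemma nth_cons0 vs k : vs`_k \in 0 :: vs.
Proof.
rewrite inE; have [kn|kn] := ltnP k (size vs); first by rewrite mem_nth ?orbT.
by rewrite nth_default// eqxx.
Qed.

(** At each time at most one bump is nonzero, hence the motion is on one single
    spoke; this is what keeps the diameter of the path under control. *)
Lemma spokes_segment vs s :
  exists2 x, x \in 0 :: vs & segment 0 x (spokes vs s).
Proof.
have [[k kn sk]|far] :=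
    pselect (exists2 k, (k < size vs)%N & `|s - bump_center k| < 2).
  exists vs`_k; first exact: nth_cons0.
  exists (bump (s - bump_center k)); first by rewrite /= in_itv/= bump_ge0 bump_le1.
  by rewrite (spokesE _ _ _ kn sk) scaler0 add0r.
exists 0; first by rewrite inE eqxx.
exists 0; first by rewrite /= in_itv/= lexx ler01.
rewrite !scaler0 addr0 spokes_eq0// => k kn.
by rewrite leNgt; apply/negP => sk; apply: far; exists k.
Qed.

Lemma spokes_continuous vs : continuous (spokes vs).
Proof.
apply: (@continuous_big _ _ _ _ _ (@add_continuous _)) => k _ s.
apply: cvgZr_tmp; apply: (@continuous_comp _ _ _ (fun s => s - bump_center k) bump).
  by apply: cvgB; [exact: cvg_id|exact: cvg_cst].
exact: bump_continuous.
Qed.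

Lemma unit_loop_continuous : continuous unit_loop.
Proof.
move=> s; have lin : {for s, continuous (fun s => 2 * pi * s)}.
  by apply: cvgMl_tmp; exact: cvg_id.
apply: (@cvg_pair _ _ _ (nbhs s) (nbhs (cos _)) (nbhs (sin _))).
  exact: (continuous_comp lin (@continuous_cos R _)).
exact: (continuous_comp lin (@continuous_sin R _)).
Qed.

Lemma unit_loop_norm s : enorm (unit_loop s) = 1.
Proof. by rewrite /enorm/= cos2Dsin2 sqrtr1. Qed.

Lemma unit_loopDn s k : unit_loop (s + k%:R) = unit_loop s.
Proof.
have E : 2 * pi * (s + k%:R) = 2 * pi * s + (pi *+ 2) *+ k :> R.
  by rewrite mulrDr mulr_natr [2 * pi]mulr_natl.
by rewrite /unit_loop E (periodicn (@cosD2pi R)) (periodicn (@sinD2pi R)).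
Qed.

(** The parameter is an angle in [-pi, pi] divided by a full turn, so it lies
    within the plateau of a bump. *)
Lemma unit_loop_surj u : enorm u = 1 -> exists2 s, `|s| <= 1 & unit_loop s = u.
Proof.
move=> u1; have uu : u.1 ^+ 2 + u.2 ^+ 2 = 1 by rewrite -sqr_enorm u1 expr1n.
have u11 : -1 <= u.1 <= 1 by rewrite -ler_norml -u1 norm_fst_le.
have p0 := pi_gt0 R.
have sE : Num.sqrt (1 - u.1 ^+ 2) = `|u.2|.
  by rewrite -uu addrAC subrr add0r sqrtr_sqr.
have pp0 : 0 < 2 * pi :> R by rewrite mulr_gt0.
have key (th : R) : 2 * pi * (th / (2 * pi)) = th by rewrite mulrC divfK// gt_eqF.
have th1 : `|acos u.1 / (2 * pi)| <= 1.
  have a0 := acos_ge0 u11; have api := acos_lepi u11.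
  rewrite ger0_norm; last exact: divr_ge0 a0 (ltW pp0).
  by rewrite ler_pdivrMr// mul1r; lra.
have [u2|u2] := leP 0 u.2.
  exists (acos u.1 / (2 * pi)) => //; apply: plane_eq => /=; rewrite key.
    by rewrite acosK// in_itv.
  by rewrite sin_acos// sE ger0_norm.
exists (- (acos u.1 / (2 * pi))); first by rewrite normrN.
apply: plane_eq => /=; rewrite mulrN key.
  by rewrite cosN acosK// in_itv.
by rewrite sinN sin_acos// sE ltr0_norm// opprK.
Qed.

Lemma flower_closed vs e : closed_path (flower vs e).
Proof.
split.
  apply: continuous_subspaceT => t.
  have lin : {for t, continuous (fun t => 4 * (size vs)%:R * t)}.
    by apply: cvgMl_tmp; exact: cvg_id.
  apply: cvgD; first exact: (continuous_comp lin (@spokes_continuous vs _)).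
  by apply: cvgZl_tmp; exact: (continuous_comp lin (@unit_loop_continuous _)).
rewrite /flower mulr0 mulr1 !spokes_eq0.
- by rewrite -natrM -[X in _ = _ + e *: unit_loop X]add0r unit_loopDn.
- move=> k kn; rewrite /bump_center; move: kn; rewrite -(ler_nat R) -natr1 => kn.
  by rewrite ger0_norm; lra.
- move=> k kn; rewrite /bump_center sub0r normrN.
  by rewrite ger0_norm ?lerDr ?addr_ge0 ?mulr_ge0.
Qed.

(** The spokes stay in the union of segments from 0 to the points of vs, whose
    diameter is that of its vertices, and the rotation adds e at either end. *)
Lemma flower_diam vs e d : 0 <= e ->
  (forall x y, x \in 0 :: vs -> y \in 0 :: vs -> enorm (x - y) <= d) ->
  diam (trace (flower vs e)) <= d + 2 * e.
Proof.
move=> e0 vd; have zvs : 0 \in 0 :: vs by rewrite inE eqxx.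
have d0 : 0 <= d by have := vd _ _ zvs zvs; rewrite subrr enorm0.
apply: diam_le; first lra.
move=> _ _ [t _ <-] [t' _ <-]; rewrite /flower.
set s := _ * t; set s' := _ * t'.
rewrite opprD addrACA; apply: (le_trans (enormD _ _)); apply: lerD.
  have [x xv xs] := spokes_segment vs s; have [y yv ys] := spokes_segment vs s'.
  exact: (segment_diam_le _ _ _ _ _ _ _ (vd _ _ zvs zvs) (vd _ _ zvs yv)
                          (vd _ _ xv zvs) (vd _ _ xv yv) xs ys).
rewrite -scalerN -scalerDr enormZ ger0_norm// mulrC ler_wpM2r//.
by apply: (le_trans (enormD _ _)); rewrite enormN !unit_loop_norm.
Qed.

Lemma flower_circle vs e k u : (k < size vs)%N -> enorm u = 1 ->
  trace (flower vs e) (vs`_k + e *: u).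
Proof.
move=> kn /unit_loop_surj[s s1 <-].
have n0 : 0 < (size vs)%:R :> R by rewrite ltr0n (leq_ltn_trans _ kn).
exists ((s + bump_center k) / (4 * (size vs)%:R)).
  move: kn; rewrite -(ler_nat R) -natr1 => kn.
  move: s1; rewrite ler_norml => /andP[s1 s2].
  have k0 : 0 <= k%:R :> R by [].
  rewrite /= in_itv/=; apply/andP; split.
    by rewrite divr_ge0// /bump_center; lra.
  by rewrite ler_pdivrMr /bump_center; lra.
have tE : 4 * (size vs)%:R * ((s + bump_center k) / (4 * (size vs)%:R)) =
    s + bump_center k by field; rewrite gt_eqF.
rewrite /flower tE.
rewrite (spokesE _ _ _ kn) addrK ?bump_eq1 ?scale1r//; last first.
  by rewrite (le_lt_trans s1)// ltr1n.
congr (_ + _ *: _).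
by rewrite /bump_center -natrM -natrD unit_loopDn.
Qed.

(** The path draws a circle of radius e around each point of vs, and F° is convex,
    so the whole disc follows the circle. *)
Lemma flower_disc (F : set (plane R)) vs e a Q : convex_set F ->
  place a Q (trace (flower vs e)) `<=` F° ->
  forall x w, x \in vs -> enorm w <= e -> F° (a + mxact Q (x + w)).
Proof.
move=> cF gF x w xv; apply: (convex_circle F°); first exact: convex_interior.
move=> u u1; apply: gF; exists (x + e *: u) => //.
have /(nthP 0)[k kn <-] := xv; exact: flower_circle.
Qed.

End Flower.

(** * Escape paths, tours and covers *)

Section Escape.
Context {R : realType}.
Implicit Types (x y z a u w p : plane R) (Q P : 'M[R]_2) (c d e s t : R).
Implicit Types (F S : set (plane R)) (g : R -> plane R).

Lemma place_continuous a Q : O2 Q -> continuous (fun x => a + mxact Q x).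
Proof.
move=> oQ; apply: isometry_continuous => x y.
by rewrite opprD addrACA subrr add0r -mxactB enorm_mxact.
Qed.

Lemma compact_trace g : closed_path g -> compact (trace g).
Proof.
by move=> [cg _]; apply: continuous_compact => //; exact: segment_compact.
Qed.

Lemma connected_trace g : closed_path g -> connected (trace g).
Proof.
move=> [cg _]; apply: connected_continuous_connected => //.
exact: segment_connected.
Qed.

(** Place the path so that its starting point falls on x with orientation Q. The
    placed trace meets F at x but is not inside F°, hence it crosses the boundary;
    pulling the crossing back gives a point of the neighborhood. *)
Lemma escape_meets_neighborhood F g x Q : compact F -> escape_path F g ->
  config F (x, Q) -> exists2 p, trace g p & neighborhood F (x, Q) (p - g 0).
Proof.
move=> cF [clg escg] [/= Fx oQ].
pose a := x - mxact Q (g 0).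
have g0 : trace g (g 0) by exists 0 => //; rewrite /= in_itv/= lexx ler01.
have [||||_ [p gp <-] bp] := connected_boundary (place a Q (trace g)) F.
- apply: connected_continuous_connected; first exact: connected_trace.
  by apply: continuous_subspaceT; exact: place_continuous.
- by apply: compact_closed => //; exact: norm_hausdorff.
- by exists x; split => //; exists (g 0) => //; rewrite subrK.
- exact: escg.
exists p => //; exists (a + mxact Q p) => //=.
by rewrite /a -[_ + mxact Q p]addrA [x + _]addrC addrK addrC -mxactB mxactK.
Qed.

Lemma tour_vertices n (pi : 'S_n) (p : 'I_n -> plane R) k :
  (0 :: [seq p (pi i) | i <- enum 'I_n])`_k \in 0 :: codom p.
Proof.
set s := [seq _ | _ <- _]; have [ks|ks] := ltnP k (size (0 :: s)); last first.
  by rewrite nth_default// inE eqxx.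
have := mem_nth 0 ks; rewrite !inE => /orP[->//|/mapP[i _ ->]].
by rewrite codom_f orbT.
Qed.

(** The norm is convex, so distances in a polygonal tour are bounded by those
    between its vertices. *)
Lemma tour_diam_le n (pi : 'S_n) (p : 'I_n -> plane R) d :
  (forall x y, x \in 0 :: codom p -> y \in 0 :: codom p -> enorm (x - y) <= d) ->
  forall x y, tour pi p x -> tour pi p y -> enorm (x - y) <= d.
Proof.
move=> pd x y [k _ xk] [l _ yl].
by apply: segment_diam_le xk yl; apply: pd; exact: tour_vertices.
Qed.

Lemma tour_bounded n (pi : 'S_n) (p : 'I_n -> plane R) :
  exists B, forall x y, tour pi p x -> tour pi p y -> enorm (x - y) <= B.
Proof.
have sum_ge (f : plane R -> R) (V : seq (plane R)) x :
    (forall y, 0 <= f y) -> x \in V -> f x <= \sum_(y <- V) f y.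
  by move=> f0 xV; rewrite (big_rem x)//= lerDl sumr_ge0.
exists (\sum_(x <- 0 :: codom p) \sum_(y <- 0 :: codom p) enorm (x - y)).
apply: tour_diam_le => x y xp yp.
apply: (le_trans (sum_ge (fun y => enorm (x - y)) _ y _ yp)).
  by move=> ?; exact: enorm_ge0.
apply: (sum_ge (fun x => \sum_(y <- 0 :: codom p) enorm (x - y))) => // ?.
by apply: sumr_ge0 => ? _; exact: enorm_ge0.
Qed.

Lemma tour_mem n (pi : 'S_n) (p : 'I_n -> plane R) x :
  x \in 0 :: codom p -> tour pi p x.
Proof.
have seg0 (a b : plane R) : segment a b a.
  by exists 0; rewrite /= ?in_itv/= ?lexx ?ler01// subr0 scale1r scale0r addr0.
rewrite inE => /orP[/eqP->|/codomP[j ->]]; first by exists 0%N => //=.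
exists ((pi^-1)%g j).+1 => /=; first by rewrite ltnS.
have -> : p j = [seq p (pi k) | k <- enum 'I_n]`_((pi^-1)%g j).
  by rewrite (nth_map j) ?size_enum_ord// nth_ord_enum permKV.
exact: seg0.
Qed.

(** An escape path, translated to start at 0, visits every neighborhood. A tour
    through points of its trace has no larger diameter. *)
Lemma sampled_opt_le_escape F n (xi : 'I_n -> plane R * 'M[R]_2) g :
  compact F -> (forall j, config F (xi j)) -> escape_path F g ->
  sampled_opt F xi <= diam (trace g).
Proof.
move=> cF xiF escg; have [clg _] := escg; have cg := compact_trace g clg.
have meet j : exists p, trace g p /\ neighborhood F (xi j) (p - g 0).
  have := xiF j; case: (xi j) => x Q /(escape_meets_neighborhood F g x Q cF escg).
  by move=> [p gp np]; exists p.
have [q qP] := choice meet; pose p j := q j - g 0.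
have g0 : trace g (g 0) by exists 0 => //; rewrite /= in_itv/= lexx ler01.
have vert x : x \in 0 :: codom p -> trace g (x + g 0).
  rewrite inE => /orP[/eqP->|/codomP[j ->]]; first by rewrite add0r.
  by rewrite /p subrK; case: (qP j).
have le_d : diam (tour 1%g p) <= diam (trace g).
  apply: diam_le; first exact: diam_ge0.
  apply: tour_diam_le => x y /vert gx /vert gy.
  by have := compact_le_diam _ _ _ cg gx gy; rewrite opprD addrACA subrr addr0.
apply: le_trans le_d; apply: ge_inf; last first.
  by exists 1%g, p; split => // j; case: (qP j).
by exists 0 => _ [pi [p' [_ ->]]]; exact: diam_ge0.
Qed.

Lemma escape_diam_le F g : escape_path F g -> escape_diam F <= diam (trace g).
Proof.
move=> escg; apply: ge_inf; last by exists g.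
by exists 0 => _ [h _ <-]; exact: diam_ge0.
Qed.

Lemma finite_net_ge0 F e (N : set (plane R * 'M[R]_2)) :
  F !=set0 -> finite_net F e N -> 0 <= e.
Proof.
move=> [x Fx] [_ _ net].
have [|xi _] := net (x, 1%:M); first by split => //=; rewrite /O2/= trmx1 mulmx1.
apply: le_trans; rewrite addr_ge0 ?enorm_ge0// mulr_ge0 ?opnorm_ge0 ?diam_ge0//.
Qed.

(** Let (a, Q) place the flower inside F°. Since 0 is among the points visited, a
    is in F, so some net point (x, P) is within e of (a, Q). Its tour point p_j is
    sent by (x, P) to a boundary point y of F, and (a, Q) sends it to within e of
    y because |p_j| <= diam F, which is the weight of the rotation part in the
    metric. So y is in the copy of the disc of radius e around p_j, hence in F°,
    which is absurd. *)
Lemma net_flower_escape F n (xi : 'I_n -> plane R * 'M[R]_2) e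
    (p : 'I_n -> plane R) :
  compact F -> convex_set F -> 0 <= e -> finite_net F e (range xi) ->
  (forall j, neighborhood F (xi j) (p j)) ->
  escape_path F (flower (0 :: codom p) e).
Proof.
move=> cptF cF e0 [_ xiF net] pN; split=> [|a Q oQ sub]; first exact: flower_closed.
have clF : closed F by apply: compact_closed => //; exact: norm_hausdorff.
have disc := flower_disc F _ _ _ _ cF sub.
have Fa : F a.
  apply: interior_subset; have := disc 0 0; rewrite addr0 mxact0 addr0 enorm0.
  by apply => //; rewrite inE eqxx.
have [_ [j _ <-] dj] := net (a, Q) (conj Fa oQ).
have [/= xF oP] := xiF _ (imageT xi j); have [y [cy nFy] pE] := pN j.
have Fy : F y by rewrite (closure_id F).1.
set x := (xi j).1 in xF pE; set P := (xi j).2 in oP pE.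
have pP : mxact P (p j) = y - x by rewrite -pE mxactKT.
have pd : enorm (p j) <= diam F.
  by rewrite -(enorm_mxact P)// pP; exact: compact_le_diam.
(* The vector of the disc around p j that (a, Q) maps onto y. *)
have yE : a + mxact Q (p j + (mxact Q^T (y - a) - p j)) = y.
  by rewrite [p j + _]addrC subrK mxactKT// addrC subrK.
apply: nFy; rewrite -yE; apply: disc; first by rewrite inE codom_f orbT.
rewrite -(enorm_mxact Q)// mxactB mxactKT//.
have -> : y - a - mxact Q (p j) = (x - a) + (mxact P (p j) - mxact Q (p j)).
  by rewrite pP addrA [_ + (y - x)]addrC addrA subrK.
apply: le_trans dj; rewrite /config_dist/=.
apply: (le_trans (enormD _ _)); apply: lerD; first by rewrite enormBC.
rewrite enormBC -mxact_subl mulrC; apply: (le_trans (mxact_le_opnorm _ _)).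
by rewrite ler_wpM2l// opnorm_ge0.
Qed.

(** The positivity of the sampled optimum ensures that the infimum defining it is
    over a nonempty set. A feasible tour then also gives an escape path, so that
    the escape diameter is an infimum over a nonempty set as well. *)
Lemma sampled_opt_bounds F n (xi : 'I_n -> plane R * 'M[R]_2) e :
  compact F -> convex_set F -> F !=set0 -> finite_net F e (range xi) ->
  0 < sampled_opt F xi ->
  sampled_opt F xi <= escape_diam F <= sampled_opt F xi + 2 * e.
Proof.
move=> cptF cF F0 net D0; have e0 := finite_net_ge0 _ _ _ F0 net.
have [_ xiF _] := net.
have [_ [pi0 [p0 [p0N _]]]] : [set d | exists (pi : 'S_n) (p : 'I_n -> plane R),
    (forall j, neighborhood F (xi j) (p j)) /\ d = diam (tour pi p)] !=set0.
  apply/set0P; apply: contraTneq D0 => set00.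
  by rewrite /sampled_opt set00 inf0 ltxx.
apply/andP; split.
  have esc0 := net_flower_escape _ _ _ _ _ cptF cF e0 net p0N.
  apply: lb_le_inf; first by eexists; exists (flower (0 :: codom p0) e).
  move=> _ [g escg <-]; apply: sampled_opt_le_escape => // j.
  by apply: xiF; exists j.
rewrite -lerBlDr; apply: lb_le_inf; first by eexists; exists pi0, p0; split.
move=> _ [pi [p [pN ->]]]; rewrite lerBlDr.
apply: le_trans (escape_diam_le _ _ (net_flower_escape _ _ _ _ _ cptF cF e0 net pN)) _.
have [B tB] := tour_bounded _ pi p.
(* The spokes start from 0, which is also a vertex of the tour. *)
have dup x : x \in [:: 0, 0 & codom p] -> x \in 0 :: codom p.
  by rewrite !inE orbA orbb.
apply: flower_diam => // x y /dup xp /dup yp.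
by apply: (enorm_le_diam _ _ _ _ tB); exact: tour_mem.
Qed.

(** A set S of diameter at most 1, dilated by c, has diameter below the escape
    diameter, with some room left. So the flower with small radius e through an
    e-net of the dilated S is too small to escape: some copy of it lies in F°, and
    with it the e-neighborhood of the net, which contains the dilated S. *)
Lemma scaled_universal_cover F c : compact F -> convex_set F -> F° !=set0 ->
  0 < c -> c < escape_diam F -> universal_cover [set x | F (c *: x)].
Proof.
move=> cptF cF [z Fz] c0 cD; have /convex_setP cF' := cF.
have cN0 : c != 0 by rewrite gt_eqF.
have preE : [set x | F (c *: x)] = (fun x => c^-1 *: x) @` F.
  apply/seteqP; split => [x Fx|_ [x Fx <-]]; last first.
    by rewrite /= scalerA mulfV// scale1r.
  by exists (c *: x) => //; rewrite scalerA mulVf// scale1r.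
split.
- rewrite preE; apply: continuous_compact => //.
  by apply: continuous_subspaceT; exact: scaler_continuous.
- apply/convex_setP => x y t t0 t1 Fx Fy /=.
  by rewrite scalerDr !scalerA ![c * _]mulrC -!scalerA; exact: cF'.
- exists (c^-1 *: z); move: Fz => /interior_enormP[e e0 eF].
  apply/interior_enormP; exists (e / c); first exact: divr_gt0.
  move=> y yz; apply: eF; rewrite -(scale1r z) -(mulfV cN0) -scalerA -scalerBr.
  by rewrite enormZ gtr0_norm// mulrC -ltr_pdivlMr.
move=> S cS S1; have [->|/set0P[s0 Ss0]] := eqVneq S set0.
  by exists 0, 1%:M; split; [rewrite /O2/= trmx1 mulmx1|move=> _ [x []]].
(* The flower has diameter at most c + 2e, half-way to the escape diameter. *)
pose e := (escape_diam F - c) / 4; have e0 : 0 < e by rewrite divr_gt0 ?subr_gt0.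
have ec0 : 0 < e / c by exact: divr_gt0.
have [s [sS snet]] := compact_net S _ cS ec0.
(* Based at s0 so that the origin, which the flower visits, is in the set. *)
pose vs := [seq c *: (x - s0) | x <- s].
have vsS x : x \in 0 :: vs -> exists2 y, S y & x = c *: (y - s0).
  rewrite inE => /orP[/eqP->|/mapP[y /sS Sy ->]]; last by exists y.
  by exists s0; rewrite // subrr scaler0.
have /existsNP[a /existsNP[Q /not_implyP[oQ /contrapT sub]]] :
    ~ forall a Q, O2 Q -> ~ (place a Q (trace (flower vs e)) `<=` F°).
  move=> esc; have := escape_diam_le _ _ (conj (flower_closed vs e) esc).
  have : diam (trace (flower vs e)) <= c + 2 * e.
    apply: flower_diam => [|x y /vsS[x' Sx ->] /vsS[y' Sy ->]]; first exact: ltW.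
    rewrite -scalerBr opprD addrACA subrr addr0 enormZ gtr0_norm//.
    by rewrite ler_piMr ?(ltW c0)// (le_trans _ S1)//; exact: compact_le_diam.
  by rewrite /e; lra.
exists (c^-1 *: (a - mxact Q (c *: s0))), Q; split=> // _ [x Sx <-] /=.
have [y ys xy] := snet x Sx.
rewrite scalerDr scalerA mulfV// scale1r -mxactZ.
have -> : a - mxact Q (c *: s0) + mxact Q (c *: x) =
    a + mxact Q (c *: (y - s0) + c *: (x - y)).
  rewrite -addrA -mxactN -mxactD; congr (a + mxact Q _).
  rewrite -scalerN -!scalerDr; congr (c *: _).
  by rewrite [y - s0]addrC -addrA [y + _]addrC subrK.
apply: interior_subset; apply: flower_disc cF sub _ _ _ _.
  by apply/mapP; exists y.
by rewrite enormZ gtr0_norm// mulrC -ler_pdivlMr.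
Qed.

End Escape.

(** * Area of a dilated set *)

Section Area.
Context {R : realType}.
Implicit Types (x y : plane R) (c e : R) (S F : set (plane R)).

Local Notation mu := (@lebesgue_measure R).
Local Notation mR := (measurableTypeR R).

Lemma measurable_scale c : measurable_fun [set: mR] (fun x : mR => c * x : mR).
Proof. exact: mulrl_measurable. Qed.

Lemma preimage_scale_itv c (a b : R) : 0 < c ->
  (fun x : R => c * x) @^-1` `]a, b] = `]a / c, b / c]%classic.
Proof.
move=> c0; apply/seteqP; split => x /=;
  by rewrite !in_itv/= ltr_pdivrMr// ler_pdivlMr// ![c * x]mulrC.
Qed.

(** Both sides are measures in A that agree on half-open intervals. *)
Lemma lebesgue_measure_scale c (A : set mR) : 0 < c -> measurable A ->
  mu A = (c%:E * mu ((fun x : R => (c * x)%R) @^-1` A))%E.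
Proof.
move=> c0 mA; have c0' : 0 <= c by exact: ltW.
apply: (@lebesgue_measure_unique R
  (mscale (NngNum c0') (pushforward mu (fun x : mR => c * x : mR)))) => //.
  exact: measurable_scale.
move=> ? _ [[a b] _ <-].
rewrite [RHS](_ : _ = (c%:E * mu `](a / c)%R, (b / c)%R]%classic)%E); last first.
  by rewrite -(preimage_scale_itv _ _ _ c0).
rewrite !lebesgue_measure_itv/= !lte_fin ltr_pM2r ?invr_gt0//.
case: ifPn => _; last by rewrite mule0.
by rewrite -!EFinB -EFinM; congr EFin; field; rewrite gt_eqF.
Qed.

(** By uniqueness of the product measure it suffices to compare rectangles, where
    the one-dimensional scaling applies to each side. *)
Lemma area_scale F c : 0 < c -> measurable (F : set (mR * mR)) ->
  area F = ((c ^+ 2)%:E * area [set x | F (c *: x)])%E.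
Proof.
move=> c0 mF; have c20 : 0 <= c ^+ 2 by exact: sqr_ge0.
pose f (x : mR * mR) : mR * mR := (c * x.1, c * x.2).
have mf : measurable_fun [set: mR * mR] f.
  apply: measurable_fun_pair.
    exact: (measurableT_comp (measurable_scale c) measurable_fst).
  exact: (measurableT_comp (measurable_scale c) measurable_snd).
apply: (@product_measure_unique _ _ mR mR R mu mu
  (mscale (NngNum c20) (pushforward (mu \x mu)%E f))) => //.
move=> A B mA mB.
pose A' : set mR := (fun x : R => c * x) @^-1` A.
pose B' : set mR := (fun x : R => c * x) @^-1` B.
transitivity ((c ^+ 2)%:E * (mu \x mu) (A' `*` B'))%E; first by [].
rewrite product_measure1E.
- transitivity ((c%:E * mu A') * (c%:E * mu B'))%E.
    by rewrite expr2 EFinM muleACA.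
  by congr (_ * _)%E; apply/esym/lebesgue_measure_scale.
- by rewrite -[X in measurable X]setTI; exact: measurable_scale.
- by rewrite -[X in measurable X]setTI; exact: measurable_scale.
Qed.

Definition box x e : set (plane R) :=
  `[x.1 - e, x.1 + e]%classic `*` `[x.2 - e, x.2 + e]%classic.

Lemma mem_box x y e : enorm (y - x) <= e -> box x e y.
Proof.
move=> yx; have y1 := le_trans (norm_fst_le _) yx.
have y2 := le_trans (norm_snd_le _) yx.
by rewrite /box/=; split => /=; rewrite in_itv/= -ler_distl.
Qed.

Lemma box_enorm x y e : box x e y -> enorm (y - x) <= e + e.
Proof.
rewrite /box/= => -[/=]; rewrite !in_itv/= -!ler_distl => y1 y2.
by apply: (le_trans (enorm_le_sum _)); apply: lerD.
Qed.

Lemma measurable_box x e : measurable (box x e : set (mR * mR)).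
Proof. by apply: measurableX; exact: measurable_itv. Qed.

(** A compact set is the intersection over n of the finite unions of squares of
    half-width 1/(n+1) around the points of a finite 1/(n+1)-net of it. *)
Lemma compact_measurable_plane S : compact S -> measurable (S : set (mR * mR)).
Proof.
move=> cS; have clS : closed S by apply: compact_closed => //; exact: norm_hausdorff.
have /choice[s sP] : forall n : nat, exists s : seq (plane R),
    (forall x, x \in s -> S x) /\
    forall y, S y -> exists2 x, x \in s & enorm (y - x) <= n.+1%:R^-1.
  by move=> n; apply: compact_net.
have -> : S = \bigcap_n \bigcup_(x in [set` s n]) box x n.+1%:R^-1.
  apply/seteqP; split => [y Sy n _|y Hy].
    by have [x xs xy] := (sP n).2 y Sy; exists x => //; exact: mem_box.
  rewrite (closure_id S).1// => B /interior_enormP[e e0 eB].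
  have e20 : 0 < e / 2 by rewrite divr_gt0.
  have [n ne] : exists n : nat, n.+1%:R^-1 < e / 2.
    by have [n _ /(_ n (leqnn n))] := near_infty_natSinv_lt (PosNum e20); exists n.
  have [x /= xs yx] := Hy n I; exists x; split; first exact: (sP n).1.
  apply: eB; rewrite enormBC; apply: (le_lt_trans (box_enorm _ _ _ yx)).
  by rewrite [e]splitr ltrD.
apply: bigcapT_measurable => n; rewrite bigcup_seq.
by apply: bigsetU_measurable => x _; exact: measurable_box.
Qed.

Lemma compact_area_fin_num S : compact S -> area S \is a fin_num.
Proof.
move=> cS; have [->|/set0P[x Sx]] := eqVneq S set0; first by rewrite /area measure0.
have [B SB] := compact_enorm_bounded S cS.
rewrite ge0_fin_numE /area; last exact: measure_ge0.
have SBox : S `<=` box x B by move=> y Sy; apply: mem_box; exact: SB.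
apply: (@le_lt_trans _ _ (((@lebesgue_measure R) \x (@lebesgue_measure R))%E (box x B))).
  apply: le_measure => //; rewrite inE; first exact: compact_measurable_plane.
  exact: measurable_box.
rewrite product_measure1E; [|exact: measurable_itv|exact: measurable_itv].
have itv_fin (a b : R) : (mu `[a, b]%classic < +oo)%E.
  by rewrite lebesgue_measure_itv/=; case: ifP => _; rewrite -?EFinB ltry.
apply: lte_mul_pinfty; [exact: measure_ge0| |exact: itv_fin].
by rewrite ge0_fin_numE; [exact: itv_fin|exact: measure_ge0].
Qed.

Lemma area_ge0 S : (0 <= area S)%E.
Proof. exact: measure_ge0. Qed.

End Area.

(** * The bounds on the covering constant *)

Section Covering.
Context {R : realType}.
Implicit Types (F : set (plane R)).

(** F dilated by u is a universal cover for every u above 1 / D(F). *)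
Lemma lebesgue_const_le_scaled F (u : R) : compact F -> convex_set F -> F° !=set0 ->
  0 < escape_diam F -> (escape_diam F)^-1 < u ->
  (lebesgue_const <= (fine (area F) * u ^+ 2)%:E :> \bar R)%E.
Proof.
move=> cptF cF intF D0 Du; have u0 : 0 < u by apply: lt_trans Du; rewrite invr_gt0.
have ui0 : 0 < u^-1 by rewrite invr_gt0.
have covU : universal_cover [set x | F (u^-1 *: x)].
  by apply: scaled_universal_cover => //; rewrite invf_plt.
have [cptU _ _ _] := covU.
apply: (@le_trans _ _ (area [set x | F (u^-1 *: x)])).
  by apply: ereal_inf_lbound; exists [set x | F (u^-1 *: x)].
rewrite (area_scale F _ ui0); last exact: compact_measurable_plane.
rewrite -(fineK (compact_area_fin_num _ cptU)) -EFinM lee_fin/=.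
by rewrite mulrAC exprVn mulVf ?mul1r// expf_neq0// gt_eqF.
Qed.

(** Let u decrease to 1 / D(F) in the previous bound; d is the excess of u, small
    enough for the area to grow by at most e. *)
Lemma lebesgue_const_le F : compact F -> convex_set F -> F° !=set0 ->
  0 < escape_diam F ->
  (lebesgue_const <= (fine (area F) / escape_diam F ^+ 2)%:E :> \bar R)%E.
Proof.
move=> cptF cF intF D0; set A := fine (area F); set D := escape_diam F.
have A0 : 0 <= A by apply: fine_ge0; exact: area_ge0.
pose u := D^-1; have u0 : 0 < u by rewrite invr_gt0.
apply/lee_addgt0Pr => e e0; rewrite -EFinD -exprVn -/u.
set K := A * (2 * u + 1) + 1.
have K0 : 0 < K by rewrite ltr_wpDl// mulr_ge0// addr_ge0// mulr_ge0// ltW.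
pose d := Num.min 1 (e / K).
have d0 : 0 < d by rewrite lt_min ltr01 divr_gt0.
have d1 : d <= 1 by rewrite ge_min lexx.
have dK : d * K <= e by rewrite -ler_pdivlMr// ge_min lexx orbT.
apply: (le_trans (lebesgue_const_le_scaled F (u + d) cptF cF intF D0 _)).
  by rewrite ltrDl.
rewrite lee_fin -/A -lerBlDl; apply: le_trans dK.
rewrite -mulrBr sqrrD.
have -> : u ^+ 2 + u * d *+ 2 + d ^+ 2 - u ^+ 2 = d * (2 * u + d) by ring.
rewrite mulrCA ler_pM2l// /K; apply: (@le_trans _ _ (A * (2 * u + 1))).
  by apply: ler_wpM2l => //; rewrite lerD2l.
by rewrite lerDl.
Qed.

End Covering.

Theorem corollary8 (R : realType) (F : set (plane R))
    (cptF : compact F) (cvxF : convex_set F) (intF : F° !=set0)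
    (eta : nat -> R)
    (eta_decr : nonincreasing_seq eta) (eta_cvg0 : eta @ \oo --> (0 : R))
    (M : nat -> nat) (xi : forall m, 'I_(M m) -> plane R * 'M[R]_2)
    (xi_inj : forall m, injective (xi m))
    (xi_net : forall m, finite_net F (eta m) (range (xi m))) :
  let A := fine (area F) in
  let D := fun m => sampled_opt F (xi m) in
  let DF := escape_diam F in
  (forall m, 0 < D m ->
    [/\ (lebesgue_const <= (A / DF ^+ 2)%:E)%E,
        A / DF ^+ 2 <= A / D m ^+ 2,
        A / (D m + 2 * eta m) ^+ 2 <= A / DF ^+ 2 &
        (lebesgue_const <= (A / D m ^+ 2)%:E)%E]) /\
  ((\forall m \near \oo, 0 < D m) ->
    (fun m => A / D m ^+ 2) @ \oo --> A / DF ^+ 2 /\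
    (fun m => A / (D m + 2 * eta m) ^+ 2) @ \oo --> A / DF ^+ 2).
Proof.
move=> A D DF.
have A0 : 0 <= A by apply: fine_ge0; exact: area_ge0.
have F0 : F !=set0 by case: intF => x /interior_subset; exists x.
have bounds m : 0 < D m -> D m <= DF <= D m + 2 * eta m.
  exact: sampled_opt_bounds.
have quot (s t : R) : 0 < s -> s <= t -> A / t ^+ 2 <= A / s ^+ 2.
  move=> s0 st; have t0 : 0 < t by exact: lt_le_trans st.
  apply: ler_wpM2l => //; rewrite lef_pV2 ?posrE ?exprn_gt0//.
  by rewrite ler_sqr ?nnegrE// ltW.
split=> [m Dm|Dpos].
  have /andP[lo hi] := bounds m Dm; have DF0 : 0 < DF by exact: lt_le_trans lo.
  have L := lebesgue_const_le F cptF cvxF intF DF0.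
  split; [exact: L|exact: quot|exact: quot|].
  by apply: (le_trans L); rewrite lee_fin; exact: quot.
have DF0 : 0 < DF.
  have [m _ /(_ m (leqnn m))/= Dm] := Dpos.
  by have /andP[lo _] := bounds m Dm; exact: lt_le_trans lo.
have eta2 : (fun m => 2 * eta m) @ \oo --> (0 : R).
  by rewrite -[X in _ --> X](mulr0 2); exact: cvgMl_tmp.
have Dcvg : D @ \oo --> DF.
  have lo_cvg : (fun m => DF - 2 * eta m) @ \oo --> DF.
    by rewrite -[X in _ --> X]subr0; apply: cvgB => //; exact: cvg_cst.
  apply: squeeze_cvgr lo_cvg (cvg_cst DF).
  near=> m; have Dm : 0 < D m by near: m.
  by have /andP[-> hi] := bounds m Dm; rewrite lerBlDr hi.
have quot_cvg (u : nat -> R) : u @ \oo --> DF ->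
    (fun m => A / u m ^+ 2) @ \oo --> A / DF ^+ 2.
  move=> uDF; apply: cvgMl_tmp; apply: cvgV; first by rewrite expf_neq0// gt_eqF.
  by rewrite expr2; exact: cvgM.
split; apply: quot_cvg => //.
by rewrite -[X in _ --> X]addr0; exact: cvgD.
Unshelve. all: by end_near.
Qed.
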